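(* Suppose that $W_{\boldsymbol\lambda}$ is a conditionally positive definite (CPD) unilateral weighted shift with weights $\boldsymbol\lambda=\{\lambda_n\}_{n=0}^\infty$ such that $$\lambda_0=\lambda_1=1.$$ Then $W_{\boldsymbol\lambda}$ is the unilateral shift.
   Context: A real sequence $\{\gamma_n\}_{n=0}^\infty$ is CPD if $\sum_{i,j=0}^k \gamma_{i+j}\alpha_i\bar\alpha_j\geq 0$ for every finite sequence $\alpha_0,\dots,\alpha_k\in\mathbb{C}$ with $\sum_{j=0}^k\alpha_j=0$. A bounded operator $T$ on a complex Hilbert space $\mathcal{H}$ is CPD if $\{\|T^nh\|^2\}_{n=0}^\infty$ is CPD for every $h\in\mathcal{H}$. For a bounded sequence $\boldsymbol\lambda=\{\lambda_n\}_{n=0}^\infty$ of positive reals, $W_{\boldsymbol\lambda}$ is the bounded operator on $\ell^2$ with $W_{\boldsymbol\lambda}e_n=\lambda_ne_{n+1}$ for $n\geq0$ ($\{e_n\}$ the standard orthonormal basis). The unilateral shift is $W_{\boldsymbol\lambda}$ with $\lambda_n=1$ for all $n\geq0$. *)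

(* Defs.v *)
From HB Require Import structures.
From mathcomp Require Import all_boot all_order all_algebra.
From mathcomp Require Import all_classical all_reals all_analysis.
From mathcomp Require Import complex ring lra.

Set Implicit Arguments.
Unset Strict Implicit.
Unset Printing Implicit Defensive.

Import Order.TTheory GRing.Theory Num.Theory.
Import numFieldNormedType.Exports.
Import ComplexField.Normc ComplexField.

Local Open Scope classical_set_scope.
Local Open Scope complex_scope.
Local Open Scope ring_scope.

(* In R[i], [0 <= z] means that z is real and nonnegative. *)
Definition cpd_seq (R : realType) (gamma : nat -> R) : Prop :=
  forall (k : nat) (alpha : 'I_k.+1 -> R[i]),
    \sum_(j < k.+1) alpha j = 0 ->
    0 <= \sum_(i < k.+1) \sum_(j < k.+1)
           (gamma (i + j)%N)%:C * alpha i * (alpha j)^*.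

(* Norms on a normed module over R[i] are R[i]-valued (and real), whence complex.Re.
   Only the norm of the Hilbert space is involved. *)
Definition cpd_operator (R : realType) (H : normedModType R[i])
    (T : {linear H -> H}) : Prop :=
  forall h : H, cpd_seq (fun n => complex.Re (`|iter n T h| ^+ 2)).

Section SquareSummable.
Variable R : realType.
Implicit Types f g : nat -> R[i].

Definition sqnorms f : R^nat := fun n => normc (f n) ^+ 2.

Definition square_summable : {pred nat -> R[i]} :=
  mem [set f | cvgn (series (sqnorms f))].

Definition l2_sqnorm f : R := limn (series (sqnorms f)).

Lemma sqnorms_ge0 f n : 0 <= sqnorms f n.
Proof. exact: sqr_ge0. Qed.

Lemma series_sqnorms_nd f : nondecreasing_seq (series (sqnorms f)).
Proof. by apply: nondecreasing_series => n _ _; exact: sqnorms_ge0. Qed.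

Lemma square_summableP f :
  f \in square_summable <-> cvgn (series (sqnorms f)).
Proof. by rewrite inE. Qed.

Lemma square_summable_le f (M : R) :
  (forall n, series (sqnorms f) n <= M) ->
  f \in square_summable /\ l2_sqnorm f <= M.
Proof.
move=> fM; have cf : cvgn (series (sqnorms f)).
  apply: nondecreasing_is_cvgn; first exact: series_sqnorms_nd.
  by exists M => _ [n _ <-].
split; first exact/square_summableP.
by apply: limr_le => //; exact: nearW.
Qed.

Lemma le_l2_sqnorm f n : f \in square_summable ->
  series (sqnorms f) n <= l2_sqnorm f.
Proof.
move=> /square_summableP cf.
by apply: nondecreasing_cvgn_le => //; exact: series_sqnorms_nd.
Qed.

Lemma series_sqnorms_ge0 f n : 0 <= series (sqnorms f) n.
Proof. by rewrite /series/= sumr_ge0// => i _; exact: sqnorms_ge0. Qed.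

Lemma l2_sqnorm_ge0 f : f \in square_summable -> 0 <= l2_sqnorm f.
Proof. by move=> /(le_l2_sqnorm 0); apply: le_trans; exact: series_sqnorms_ge0. Qed.

Lemma normc_ge0 (z : R[i]) : 0 <= normc z.
Proof. by case: z => a b; exact: sqrtr_ge0. Qed.

Lemma l2_sqnorm_eq0 f : f \in square_summable -> l2_sqnorm f = 0 ->
  forall n, f n = 0.
Proof.
move=> fs f0 n; apply: eq0_normc.
apply/eqP; rewrite -sqrf_eq0 eq_le sqr_ge0 andbT.
apply: le_trans (_ : series (sqnorms f) n.+1 <= 0); last first.
  by rewrite -f0; exact: le_l2_sqnorm.
by rewrite seriesSr lerDr series_sqnorms_ge0.
Qed.

Lemma sqnormsD_le (t : R) f g n : 0 < t ->
  sqnorms (f + g) n <= (1 + t) * sqnorms f n + (1 + t^-1) * sqnorms g n.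
Proof.
move=> t0; rewrite /sqnorms.
set a := normc (f n); set b := normc (g n).
apply: (@le_trans _ _ ((a + b) ^+ 2)).
  by rewrite lerXn2r ?nnegrE ?addr_ge0 ?normc_ge0// le_normcD.
rewrite -subr_ge0.
have -> : (1 + t) * a ^+ 2 + (1 + t^-1) * b ^+ 2 - (a + b) ^+ 2
        = t^-1 * (t * a - b) ^+ 2.
  by field; rewrite gt_eqF.
by rewrite mulr_ge0 ?sqr_ge0// invr_ge0 ltW.
Qed.

Lemma l2_sqnormD_le (t : R) f g : 0 < t ->
  f \in square_summable -> g \in square_summable ->
  f + g \in square_summable /\
  l2_sqnorm (f + g) <= (1 + t) * l2_sqnorm f + (1 + t^-1) * l2_sqnorm g.
Proof.
move=> t0 fs gs; apply: square_summable_le => n.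
apply: (@le_trans _ _ ((1 + t) * series (sqnorms f) n +
                       (1 + t^-1) * series (sqnorms g) n)).
  rewrite /series/= !mulr_sumr -big_split/=; apply: ler_sum => i _.
  exact: sqnormsD_le.
by rewrite lerD// ler_wpM2l ?le_l2_sqnorm// addr_ge0// ltW// invr_gt0.
Qed.

Lemma sqnormsZ (c : R[i]) f : sqnorms (c *: f) = normc c ^+ 2 *: sqnorms f.
Proof.
apply/funext => n; rewrite -[RHS]/(normc c ^+ 2 * normc (f n) ^+ 2).
by rewrite -exprMn -normcM.
Qed.

Lemma l2_sqnormZ (c : R[i]) f : f \in square_summable ->
  c *: f \in square_summable /\
  l2_sqnorm (c *: f) = normc c ^+ 2 * l2_sqnorm f.
Proof.
move=> /square_summableP cf.
have E : series (sqnorms (c *: f)) = normc c ^+ 2 *: series (sqnorms f).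
  apply/funext => n; rewrite sqnormsZ /series/= fctE /= [RHS]mulr_sumr.
  exact: eq_bigr.
rewrite /l2_sqnorm E; split; last by rewrite limZr.
by apply/square_summableP; rewrite E; exact: is_cvgZr.
Qed.

Lemma l2_submod_closed : submod_closed square_summable.
Proof.
split=> [|c f g fs gs].
- apply: (proj1 (@square_summable_le _ 0 _)) => n.
  by rewrite /series/= big1// => i _; rewrite /sqnorms normc0 expr0n.
- apply: (proj1 (l2_sqnormD_le (ltr01) _ gs)).
  exact: (proj1 (l2_sqnormZ c fs)).
Qed.

HB.instance Definition _ :=
  GRing.isSubmodClosed.Build R[i] (nat -> R[i]) square_summable l2_submod_closed.

End SquareSummable.

Record l2 (R : realType) := L2 {
  l2_val :> nat -> R[i];
  l2_valP : l2_val \in @square_summable R }.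

HB.instance Definition _ (R : realType) := [isSub for @l2_val R].
HB.instance Definition _ (R : realType) := [Choice of l2 R by <:].
HB.instance Definition _ (R : realType) :=
  [SubChoice_isSubLmodule of l2 R by <:].

Section L2Norm.
Variable R : realType.
Implicit Types f g : l2 R.

Definition l2_norm f : R[i] := (Num.sqrt (l2_sqnorm f))%:C.

Lemma l2_normD f g : l2_norm (f + g) <= l2_norm f + l2_norm g.
Proof.
rewrite /l2_norm -rmorphD/= lecR.
have fP := l2_valP f; have gP := l2_valP g.
have := l2_sqnorm_ge0 fP; rewrite le_eqVlt => /predU1P[f0|f0].
  have -> : f = 0 by apply/val_inj/funext; exact: l2_sqnorm_eq0.
  by rewrite add0r lerDr sqrtr_ge0.
have := l2_sqnorm_ge0 gP; rewrite le_eqVlt => /predU1P[g0|g0].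
  have -> : g = 0 by apply/val_inj/funext; exact: l2_sqnorm_eq0.
  by rewrite addr0 lerDl sqrtr_ge0.
set a := Num.sqrt (l2_sqnorm f); set b := Num.sqrt (l2_sqnorm g).
have a0 : 0 < a by rewrite sqrtr_gt0.
have b0 : 0 < b by rewrite sqrtr_gt0.
have ab0 : 0 <= a + b by rewrite addr_ge0// ltW.
rewrite -[leRHS](ger0_norm ab0) -sqrtr_sqr ler_wsqrtr//.
have [_ /le_trans] := l2_sqnormD_le (divr_gt0 b0 a0) fP gP; apply.
rewrite -(sqr_sqrtr (l2_sqnorm_ge0 fP)) -(sqr_sqrtr (l2_sqnorm_ge0 gP)).
rewrite -/a -/b le_eqVlt; apply/orP; left; apply/eqP.
by field; rewrite !gt_eqF.
Qed.

Lemma l2_normZ (c : R[i]) f : l2_norm (c *: f) = `|c| * l2_norm f.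
Proof.
rewrite /l2_norm; have [_ /= ->] := l2_sqnormZ c (l2_valP f).
rewrite sqrtrM ?sqr_ge0// sqrtr_sqr ger0_norm ?normc_ge0//.
by rewrite rmorphM.
Qed.

Lemma l2_norm_eq0 f : l2_norm f = 0 -> f = 0.
Proof.
move=> /eqP; rewrite /l2_norm eq_complex/= eqxx andbT sqrtr_eq0 => f0.
apply/val_inj/funext; apply: l2_sqnorm_eq0; first exact: l2_valP.
by apply/eqP; rewrite eq_le f0 l2_sqnorm_ge0 ?l2_valP.
Qed.

End L2Norm.

HB.instance Definition _ (R : realType) :=
  @Lmodule_isNormed.Build R[i] (l2 R)
    (@l2_norm R) (@l2_normD R) (@l2_normZ R) (@l2_norm_eq0 R).

Lemma l2_sqr_norm (R : realType) (f : l2 R) :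
  `|f| ^+ 2 = (limn (series (fun n => normc (f n) ^+ 2)))%:C.
Proof.
rewrite -[`|f|]/(l2_norm f) /l2_norm -rmorphXn/= sqr_sqrtr//.
by apply: l2_sqnorm_ge0; exact: l2_valP.
Qed.

Section WeightedShift.
Variable R : realType.

Definition l2_basis_fun (n : nat) : nat -> R[i] := fun k => (k == n)%:R.

Lemma l2_basis_subproof n : l2_basis_fun n \in @square_summable R.
Proof.
apply: (proj1 (@square_summable_le _ _ 1 _)) => m.
rewrite /series/= big_mkord /sqnorms /l2_basis_fun.
have [nm|mn] := ltnP n m.
  rewrite (bigD1 (Ordinal nm))//= eqxx normc1 expr1n big1 ?addr0//.
  by move=> i; rewrite -val_eqE/= => /negPf ->; rewrite normc0 expr0n.
rewrite big1// => i _.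
by rewrite ltn_eqF ?normc0 ?expr0n// (leq_trans (ltn_ord i)).
Qed.

Definition l2_basis n : l2 R := L2 (l2_basis_subproof n).

Variable lambda : nat -> R.
Hypothesis lambda_bounded : bounded_fun lambda.

Definition weighted_shift_fun (f : nat -> R[i]) : nat -> R[i] :=
  fun n => if n is m.+1 then (lambda m)%:C * f m else 0.

Lemma bounded_weightsP : exists2 M : R, 0 < M & forall n, `|lambda n| <= M.
Proof.
have [M [Mr MP]] := lambda_bounded.
exists (`|M| + 1); first by rewrite ltr_wpDl.
by move=> n; apply: MP => //; rewrite (le_lt_trans (ler_norm _))// ltrDl.
Qed.

Lemma l2_sqnorm_weighted_shift (M : R) (f : l2 R) : 0 < M ->
  (forall n, `|lambda n| <= M) ->
  weighted_shift_fun f \in @square_summable R /\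
  l2_sqnorm (weighted_shift_fun f) <= M ^+ 2 * l2_sqnorm f.
Proof.
move=> M0 lM; apply: square_summable_le => -[|n].
  by rewrite /series/= big_geq// mulr_ge0 ?sqr_ge0// l2_sqnorm_ge0 ?l2_valP.
apply: (@le_trans _ _ (M ^+ 2 * series (sqnorms f) n)); last first.
  by rewrite ler_wpM2l ?sqr_ge0// le_l2_sqnorm ?l2_valP.
rewrite /series/= big_nat_recl//= {1}/sqnorms normc0 expr0n add0r mulr_sumr.
apply: ler_sum => i _; rewrite /sqnorms/= normcM exprMn.
rewrite ler_wpM2r ?sqr_ge0// lerXn2r ?nnegrE ?normc_ge0 ?(ltW M0)//.
by rewrite /= expr0n addr0 sqrtr_sqr.
Qed.

Lemma weighted_shift_subproof (f : l2 R) :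
  weighted_shift_fun f \in @square_summable R.
Proof.
have [M M0 lM] := bounded_weightsP.
exact: (proj1 (l2_sqnorm_weighted_shift f M0 lM)).
Qed.

(* By weighted_shift_is_linear, weighted_shift_continuous and
   weighted_shift_basis below, this is the bounded operator on l2 determined
   by e_n |-> lambda_n e_(n+1). *)
Definition weighted_shift (f : l2 R) : l2 R := L2 (weighted_shift_subproof f).

Lemma weighted_shift_is_linear : linear weighted_shift.
Proof.
move=> c f g; apply/val_inj/funext => -[|n] /=.
  by rewrite !fctE/= scaler0 addr0.
by rewrite !fctE/= mulrDr; congr (_ + _); exact: mulrCA.
Qed.

HB.instance Definition _ :=
  GRing.isLinear.Build R[i] (l2 R) (l2 R) _ weighted_shift
    weighted_shift_is_linear.

Lemma weighted_shift_continuous : continuous weighted_shift.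
Proof.
apply: bounded_linear_continuous; apply/linear_boundedP.
have [M M0 lM] := bounded_weightsP.
exists M%:C; split; first by rewrite complex_real.
move=> r Mr f; apply: le_trans (ler_wpM2r (normr_ge0 f) (ltW Mr)).
have [_ h] := l2_sqnorm_weighted_shift f M0 lM.
rewrite -[`|f|]/(l2_norm f) -[`|_|]/(l2_norm (weighted_shift f)).
rewrite /l2_norm -rmorphM/= lecR (le_trans (ler_wsqrtr h))//.
by rewrite sqrtrM ?sqr_ge0// sqrtr_sqr gtr0_norm.
Qed.

Lemma weighted_shift_basis n :
  weighted_shift (l2_basis n) = (lambda n)%:C *: l2_basis n.+1.
Proof.
apply/val_inj/funext => -[|k] /=; rewrite !fctE /l2_basis_fun/= ?scaler0//.
by rewrite eqSS; have [->|] := eqVneq k n; rewrite ?mulr0 ?scaler0.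
Qed.

End WeightedShift.

Arguments weighted_shift {R} lambda lambda_bounded f.

Lemma unit_weights_bounded (R : realType) : bounded_fun (fun _ : nat => 1 : R).
Proof. by exists 1; split=> // M M1 n _ /=; rewrite normr1 ltW. Qed.

Definition unilateral_shift (R : realType) : l2 R -> l2 R :=
  weighted_shift (fun _ => 1) (@unit_weights_bounded R).

Arguments unilateral_shift : clear implicits.

(* Main.v *)
Require Import Defs.
From mathcomp Require Import all_boot all_order all_algebra.
From mathcomp Require Import all_classical all_reals all_analysis.
From mathcomp Require Import complex.
From mathcomp Require Import ring lra.

Import Order.TTheory GRing.Theory Num.Theory.
Import numFieldNormedType.Exports.

Local Open Scope classical_set_scope.
Local Open Scope ring_scope.

(** Testing the operator on [e_0] shows that the moments
    [gamma n = (lambda_0 ... lambda_(n-1))^2] form a CPD sequence.  The vectors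
    [c] with zero sum are the first differences, so CPD says that the second
    differences [a n = gamma n - 2 gamma (n+1) + gamma (n+2)] have positive
    semidefinite Hankel matrices.  The two unit weights give
    [gamma 0 = gamma 1 = gamma 2], hence [a 0 = 0]; a positive semidefinite
    matrix with a zero on its diagonal has the whole corresponding row zero, so
    [a n = 0] for every [n] ([cpd_seq_diff2_eq0]).  Thus [gamma] is affine, and
    [gamma 0 = gamma 1] makes it constant, which forces every weight to be 1. *)

(** The combination [s (delta_1 - delta_0) + (delta_(n+1) - delta_n)]: its
    entries sum to zero, and evaluating the form on it sees the 2 x 2 minor of
    the Hankel matrix of second differences with rows 0 and [n]. *)
Definition diff_test {R : realType} (s : R) (n i : nat) : R :=
  s * ((i == 1%N)%:R - (i == 0%N)%:R) + ((i == n.+1)%:R - (i == n)%:R).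

Lemma sum_mul_eq_op {R : realType} (f : nat -> R) k m : (m < k)%N ->
  \sum_(i < k) f i * ((i : nat) == m)%:R = f m.
Proof.
move=> mk; rewrite (bigD1 (Ordinal mk))//= eqxx mulr1 big1 ?addr0// => i.
by rewrite -val_eqE/= => /negPf ->; rewrite mulr0.
Qed.

Lemma sum_diff_test {R : realType} (f : nat -> R) s n :
  \sum_(i < n.+2) f i * diff_test s n i
  = s * (f 1%N - f 0%N) + (f n.+1 - f n).
Proof.
have -> : \sum_(i < n.+2) f i * diff_test s n i =
    s * (\sum_(i < n.+2) f i * ((i : nat) == 1%N)%:R
         - \sum_(i < n.+2) f i * ((i : nat) == 0%N)%:R)
    + (\sum_(i < n.+2) f i * ((i : nat) == n.+1)%:R
       - \sum_(i < n.+2) f i * ((i : nat) == n)%:R).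
  rewrite -!sumrB mulr_sumr -big_split/=; apply: eq_bigr => i _.
  by rewrite /diff_test; ring.
by rewrite !sum_mul_eq_op.
Qed.

Lemma cpd_seq_real {R : realType} (gamma : nat -> R) (k : nat)
    (c : nat -> R) : cpd_seq gamma -> \sum_(i < k.+1) c i = 0 ->
  0 <= \sum_(i < k.+1) (\sum_(j < k.+1) gamma (i + j)%N * c j) * c i.
Proof.
move=> cpd c0; have := cpd k (fun i => (c i)%:C%C).
rewrite -rmorph_sum/= c0 => /(_ erefl).
rewrite -(lecR 0) rmorph_sum/=; congr (_ <= _); apply: eq_bigr => i _.
rewrite mulr_suml rmorph_sum/=; apply: eq_bigr => j _.
by rewrite !rmorphM/= conj_Creal ?complex_real//; ring.
Qed.

(** The minor with rows 0 and [n], evaluated at [(s, 1)], is [2 s a + b] with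
    [a] the second difference at [n] (its [s^2] coefficient is the vanishing
    one at 0); it is nonnegative for every [s], so [a = 0]. *)
Lemma cpd_seq_diff2_eq0 {R : realType} (gamma : nat -> R) : cpd_seq gamma ->
  gamma 2%N - 2 * gamma 1%N + gamma 0%N = 0 ->
  forall n, gamma n.+2 - 2 * gamma n.+1 + gamma n = 0.
Proof.
move=> cpd a0 n.
set a := LHS.
pose b := gamma (n + n).+2 - 2 * gamma (n + n).+1 + gamma (n + n)%N.
have ge0 s : 0 <= 2 * s * a + b.
  have c0 : \sum_(i < n.+2) diff_test s n i = 0.
    have := sum_diff_test (fun=> 1) s n; rewrite !subrr mulr0 addr0; apply: etrans.
    by apply: eq_bigr => i _; rewrite mul1r.
  have := cpd_seq_real _ _ _ cpd c0.
  under eq_bigr => i _ do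
    rewrite (sum_diff_test (fun j => gamma (i + j)%N)).
  rewrite (sum_diff_test (fun i => s * (gamma (i + 1)%N - gamma (i + 0)%N)
             + (gamma (i + n.+1)%N - gamma (i + n)%N))).
  rewrite !addnS !addSn !addn0 !add0n.
  congr (0 <= _).
  transitivity (s ^+ 2 * (gamma 2%N - 2 * gamma 1%N + gamma 0%N)
                + 2 * s * a + b); last by rewrite a0 mulr0 add0r.
  by rewrite /a /b; ring.
apply/eqP/negPn/negP => an0.
(* this [s] makes the affine function take the value -1 *)
have := ge0 (- (b + 1) / (2 * a)).
have -> : 2 * (- (b + 1) / (2 * a)) * a + b = - 1 by field.
by rewrite ler0N1.
Qed.

Lemma cpd_seq_cst {R : realType} (gamma : nat -> R) : cpd_seq gamma ->
  gamma 1%N = gamma 0%N -> gamma 2%N = gamma 0%N ->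
  forall n, gamma n = gamma 0%N.
Proof.
move=> cpd g1 g2 n.
have a0 : gamma 2%N - 2 * gamma 1%N + gamma 0%N = 0 by rewrite g1 g2; ring.
suff [] : gamma n = gamma 0%N /\ gamma n.+1 = gamma 0%N by [].
elim: n => [//|n [gn gn1]]; split=> //.
by have := cpd_seq_diff2_eq0 _ cpd a0 n; rewrite gn gn1; lra.
Qed.

Lemma norm_l2_basis (R : realType) n : `|l2_basis R n| = 1.
Proof.
apply/eqP; rewrite -(@eqrXn2 _ 2)// expr1n l2_sqr_norm.
suff -> : limn (series (fun m => ComplexField.Normc.normc (l2_basis R n m) ^+ 2)) = 1.
  by rewrite rmorph1.
apply: lim_near_cst; first exact: norm_hausdorff.
near=> m.
have nm : (n < m)%N by near: m; exact: nbhs_infty_gt.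
rewrite /series/= big_mkord.
rewrite -[RHS](sum_mul_eq_op (fun=> 1) _ _ nm); apply: eq_bigr => i _.
rewrite mul1r /= /l2_basis_fun; case: eqP => _.
  by rewrite ComplexField.Normc.normc1 expr1n.
by rewrite ComplexField.Normc.normc0 expr0n.
Unshelve. all: by end_near. Qed.

Lemma iter_weighted_shift_basis0 (R : realType) (lambda : nat -> R)
    (lambda_bounded : bounded_fun lambda) n :
  iter n (weighted_shift lambda lambda_bounded) (l2_basis R 0)
  = (\prod_(i < n) lambda i)%:C%C *: l2_basis R n.
Proof.
elim: n => [|n IHn]; first by rewrite big_ord0 scale1r.
by rewrite iterS IHn linearZ/= weighted_shift_basis scalerA -rmorphM/= big_ord_recr.
Qed.

Theorem theorem8p4 (R : realType) (lambda : nat -> R)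
    (lambda_gt0 : forall n : nat, 0 < lambda n)
    (lambda_bounded : bounded_fun lambda) :
  cpd_operator (weighted_shift lambda lambda_bounded) ->
  lambda 0%N = 1 ->
  lambda 1%N = 1 ->
  weighted_shift lambda lambda_bounded = unilateral_shift R.
Proof.
move=> cpdW l0 l1.
pose p n := \prod_(i < n) lambda i.
have p_gt0 n : 0 < p n by apply: prodr_gt0.
have cpd : cpd_seq (fun n => p n ^+ 2).
  have := cpdW (l2_basis R 0); congr cpd_seq; apply/funext => n.
  rewrite iter_weighted_shift_basis0 normrZ norm_l2_basis mulr1 -/(p n).
  by rewrite ger0_norm ?ler0c ?ltW// -(rmorphXn (real_complex R)).
have p_eq1 n : p n = 1.
  apply/eqP; rewrite -(@eqrXn2 _ 2) ?ltW// expr1n; apply/eqP.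
  rewrite (cpd_seq_cst _ cpd) /p ?big_ord_recr ?big_ord0/= ?l0 ?l1 ?mulr1 ?expr1n//.
have lambda1 n : lambda n = 1.
  by have := p_eq1 n.+1; rewrite /p big_ord_recr/= -/(p n) p_eq1 mul1r.
apply/funext => f; apply/val_inj/funext => -[//|n] /=.
by rewrite lambda1.
Qed.
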